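(* Let $f\colon X\to X$ be a homeomorphism of a connected compact metric space $(X,\operatorname{dist})$. Let $D\colon X^3_{\delta_0}\to\mathbb{R}$ be a catenary local metric which is locally minimizing with constant $\delta\in(0,\delta_0)$. Define $\rho(x,y)=\inf_{n\ge2}\ \inf_{a\in C^\delta_n(x,y)}\ \sum_{i=1}^{n-1}D_{a_i}(a_i,a_{i+1})$. Then $\rho$ is a catenary metric on $X$.
   Context: Let $X^3_\delta=\{(x,y,z)\in X^3:y,z\in B_\delta(x)\}$, where $B_\delta(x)$ is the open ball of radius $\delta$. A local metric is a continuous $D\colon X^3_{\delta_0}\to\mathbb{R}$, written $D_x(y,z)$, such that each $D_x$ is a metric on $B_{\delta_0}(x)$ and $D_x(x,y)=D_y(x,y)$ whenever $\operatorname{dist}(x,y)<\delta_0$. $D$ is catenary if $D_{f(x)}(f(y),f(z))-2D_x(y,z)+D_{f^{-1}(x)}(f^{-1}(y),f^{-1}(z))=D_x(y,z)$ whenever all terms are defined. $D$ is locally minimizing with constant $\delta$ if $\operatorname{dist}(x,y)<\delta$ implies $D_x(x,y)\le D_z(x,y)$ for all $z\in B_\delta(x)\cap B_\delta(y)$. $C^\delta_n(x,y)=\{a=(a_1,\dots,a_n)\in X^n: a_1=x,\ a_n=y,\ \operatorname{dist}(a_i,a_{i+1})\le\delta \text{ for } i=1,\dots,n-1\}$. A catenary metric is a metric $\rho$ on $X$ defining its topology for which there is $\delta'>0$ such that $\rho(f(x),f(y))-2\rho(x,y)+\rho(f^{-1}(x),f^{-1}(y))=\rho(x,y)$ whenever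 $\operatorname{dist}(x,y)\le\delta'$. *)

(* Defs.v *)
From Stdlib Require Import Reals Lra List ClassicalEpsilon.
Open Scope R_scope.

Section Defs.
Context {X : Type}.

Definition is_metric (d : X -> X -> R) : Prop :=
  (forall x y, 0 <= d x y) /\
  (forall x y, d x y = 0 <-> x = y) /\
  (forall x y, d x y = d y x) /\
  (forall x y z, d x z <= d x y + d y z).

Definition open_in (d : X -> X -> R) (U : X -> Prop) : Prop :=
  forall x, U x -> exists r, 0 < r /\ forall y, d x y < r -> U y.

Definition compact_metric (d : X -> X -> R) : Prop :=
  forall (I : Type) (U : I -> X -> Prop),
    (forall i, open_in d (U i)) -> (forall x, exists i, U i x) ->
    exists l : list I, forall x, exists i, In i l /\ U i x.

Definition connected_metric (d : X -> X -> R) : Prop :=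
  forall U : X -> Prop, open_in d U -> open_in d (fun x => ~ U x) ->
    (forall x, U x) \/ (forall x, ~ U x).

Definition continuous_map (d : X -> X -> R) (f : X -> X) : Prop :=
  forall x eps, 0 < eps -> exists eta, 0 < eta /\
    forall y, d x y < eta -> d (f x) (f y) < eps.

Definition homeomorphism (d : X -> X -> R) (f g : X -> X) : Prop :=
  (forall x, g (f x) = x) /\ (forall x, f (g x) = x) /\
  continuous_map d f /\ continuous_map d g.

Definition in_X3 (d : X -> X -> R) (delta : R) (x y z : X) : Prop :=
  d x y < delta /\ d x z < delta.

(* Local metric D : X^3_{delta0} -> R, written D x y z = D_x(y,z). *)
Definition local_metric (d : X -> X -> R) (delta0 : R) (D : X -> X -> X -> R) : Prop :=
  (forall x y z, in_X3 d delta0 x y z ->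
     forall eps, 0 < eps -> exists eta, 0 < eta /\
       forall x' y' z', in_X3 d delta0 x' y' z' ->
         d x x' < eta -> d y y' < eta -> d z z' < eta ->
         Rabs (D x' y' z' - D x y z) < eps) /\
  (forall x y z, d x y < delta0 -> d x z < delta0 -> 0 <= D x y z) /\
  (forall x y z, d x y < delta0 -> d x z < delta0 -> (D x y z = 0 <-> y = z)) /\
  (forall x y z, d x y < delta0 -> d x z < delta0 -> D x y z = D x z y) /\
  (forall x y z w, d x y < delta0 -> d x z < delta0 -> d x w < delta0 ->
      D x y w <= D x y z + D x z w) /\
  (forall x y, d x y < delta0 -> D x x y = D y x y).

(* catenary local metric, g being f^{-1} *)
Definition catenary_local (d : X -> X -> R) (delta0 : R) (f g : X -> X)
    (D : X -> X -> X -> R) : Prop :=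
  forall x y z,
    in_X3 d delta0 (f x) (f y) (f z) ->
    in_X3 d delta0 x y z ->
    in_X3 d delta0 (g x) (g y) (g z) ->
    D (f x) (f y) (f z) - 2 * D x y z + D (g x) (g y) (g z) = D x y z.

Definition locally_minimizing (d : X -> X -> R) (D : X -> X -> X -> R) (delta : R) : Prop :=
  forall x y, d x y < delta ->
    forall z, d x z < delta -> d y z < delta -> D x x y <= D z x y.

Definition chain_sums (d : X -> X -> R) (D : X -> X -> X -> R) (delta : R) (x y : X)
    (s : R) : Prop :=
  exists (n : nat) (a : nat -> X),
    (2 <= n)%nat /\ a 0%nat = x /\ a (n - 1)%nat = y /\
    (forall i, (i < n - 1)%nat -> d (a i) (a (S i)) <= delta) /\
    s = sum_f_R0 (fun i => D (a i) (a i) (a (S i))) (n - 2).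

Definition is_lower_bound (E : R -> Prop) (m : R) : Prop := forall s, E s -> m <= s.
Definition is_glb (E : R -> Prop) (m : R) : Prop :=
  is_lower_bound E m /\ forall b, is_lower_bound E b -> b <= m.

(* rho(x,y) = infimum of the chain sums (chosen by epsilon; it exists under
   the hypotheses of the theorem) *)
Definition rho (d : X -> X -> R) (D : X -> X -> X -> R) (delta : R) (x y : X) : R :=
  epsilon (inhabits 0) (fun r => is_glb (chain_sums d D delta x y) r).

Definition catenary_metric (d : X -> X -> R) (f g : X -> X) (r : X -> X -> R) : Prop :=
  is_metric r /\
  (forall U, open_in d U <-> open_in r U) /\
  exists delta', 0 < delta' /\ forall x y, d x y <= delta' ->
    r (f x) (f y) - 2 * r x y + r (g x) (g y) = r x y.

End Defs.

(* Main.v *)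
Require Import Defs.
From Stdlib Require Import Reals Lra Lia List Classical ClassicalEpsilon.
Open Scope R_scope.

(** Applying local minimality at an intermediate point z and then the triangle
    inequality of D_z gives
    D_x(x,y) <= D_z(x,y) <= D_z(x,z) + D_z(z,y) = D_x(x,z) + D_z(z,y),
    so (x,y) |-> D_x(x,y) satisfies the triangle inequality at scale delta.
    By compactness D_x(x,y) is bounded below by some m > 0 when
    r <= dist x y <= delta.  Hence a chain of sum less than m that starts at x
    never leaves the ball of radius r about x, and its sum is at least D_x(x,y).
    Therefore rho(x,y) = D_x(x,y) for nearby points, and the catenary identity
    for rho is that of D at (x,x,y). *)

(** * Uniform constants from compactness *)

Section CompactUniformity.
Context {X : Type} (d : X -> X -> R).
Context (Hd : is_metric d) (Hc : compact_metric d).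

Lemma ball_open (x : X) (e : R) : open_in d (fun y => d x y < e).
Proof.
  destruct Hd as (_ & _ & _ & tri).
  intros y Hy. exists (e - d x y). split; [lra|].
  intros z Hz. specialize (tri x y z). lra.
Qed.

(** A finite subcover by balls leaves finitely many constants, and since [Q] passes to smaller
    constants their minimum serves every point. *)
Lemma compact_uniform (Q : R -> X -> Prop) :
  (forall e e' x, e' <= e -> Q e x -> Q e' x) ->
  (forall x, exists e, 0 < e /\ forall y, d x y < e -> Q e y) ->
  exists e, 0 < e /\ forall x, Q e x.
Proof.
  intros anti loc.
  (* Each index carries its centre, its radius and the proof that the ball is good, so no radius has
     to be chosen as a function of the centre. *)
  pose (I := {p : X * R | 0 < snd p /\ forall y, d (fst p) y < snd p -> Q (snd p) y}).
  destruct (Hc I (fun i y => d (fst (proj1_sig i)) y < snd (proj1_sig i))) as [l Hl].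
  - intros i. apply ball_open.
  - intros x. destruct (loc x) as (e & He & HQ).
    exists (exist _ (x, e) (conj He HQ)). simpl.
    destruct Hd as (_ & d0 & _). rewrite (proj2 (d0 x x) eq_refl). exact He.
  - assert (Hmin : exists e, 0 < e /\
               forall i, In i l -> e <= snd (proj1_sig i)).
    { clear Hl. induction l as [|i l (e & He & IH)].
      - exists 1. split; [lra|]. intros i [].
      - exists (Rmin e (snd (proj1_sig i))). split.
        + apply Rmin_glb_lt; [exact He|]. apply (proj2_sig i).
        + intros j [<-|Hj]; [apply Rmin_r|].
          apply Rle_trans with e; [apply Rmin_l | auto]. }
    destruct Hmin as (e & He & Hle). exists e. split; [exact He|]. intros x.
    destruct (Hl x) as (i & Hi & Hx).
    apply anti with (snd (proj1_sig i)); [auto|].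
    apply (proj2_sig i). exact Hx.
Qed.

(** This is the tube lemma: for fixed [x] the inner use of compactness makes the constant uniform in
    [y] over a ball about [x], and the outer use then makes it uniform in [x]. *)
Lemma compact_uniform2 (P : R -> X -> X -> Prop) :
  (forall e e' x y, e' <= e -> P e x y -> P e' x y) ->
  (forall x y, exists e, 0 < e /\
     forall x' y', d x x' < e -> d y y' < e -> P e x' y') ->
  exists e, 0 < e /\ forall x y, P e x y.
Proof.
  intros anti loc.
  apply (compact_uniform (fun e x => forall y, P e x y)); [eauto|].
  intros x.
  destruct (compact_uniform (fun e y => forall x', d x x' < e -> P e x' y))
    as (e & He & HP).
  - intros e e' y Hle HP x' Hx'. apply anti with e; [exact Hle|]. apply HP. lra.
  - intros y. destruct (loc x y) as (e & He & HP). exists e. split; auto.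
  - exists e. split; auto.
Qed.

Lemma uniform_continuity (h : X -> X) (e : R) :
  continuous_map d h -> 0 < e ->
  exists eta, 0 < eta /\ forall x y, d x y < eta -> d (h x) (h y) < e.
Proof.
  intros Hh He. destruct Hd as (_ & _ & sym & tri).
  apply (compact_uniform (fun eta x => forall y, d x y < eta -> d (h x) (h y) < e)).
  - intros a b x Hab HQ y Hy. apply HQ. lra.
  - intros x. destruct (Hh x (e / 2)) as (eta & Heta & Hx); [lra|].
    exists (eta / 2). split; [lra|]. intros y Hy z Hz.
    assert (H1 := Hx y ltac:(lra)).
    assert (H2 := Hx z ltac:(specialize (tri x y z); lra)).
    specialize (tri (h y) (h x) (h z)). rewrite (sym (h y) (h x)) in tri. lra.
Qed.

End CompactUniformity.

(** * Chains and their sums *)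

Inductive chain {X : Type} (d : X -> X -> R) (D : X -> X -> X -> R) (delta : R) :
  X -> X -> R -> Prop :=
| chain_one x y : d x y <= delta -> chain d D delta x y (D x x y)
| chain_cons x z y s : d x z <= delta -> chain d D delta z y s ->
    chain d D delta x y (D x x z + s).

Section Chains.
Context {X : Type} (d : X -> X -> R) (D : X -> X -> X -> R) (delta : R).

(** Trades indexed sequences for an inductive predicate, so that concatenation, reversal and the
    lower bound go by induction on the links. *)
Lemma chain_sumsP (x y : X) (s : R) : chain_sums d D delta x y s <-> chain d D delta x y s.
Proof.
  split.
  - intros (n & a & Hn & Hx & Hy & Hstep & ->).
    (* From here there are [n + 2] points and [n + 1] links; [sum_f_R0] includes its upper index
       [n]. *)
    destruct n as [|[|n]]; [lia|lia|]. clear Hn.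
    replace (S (S n) - 1)%nat with (S n) in Hy, Hstep by lia.
    replace (S (S n) - 2)%nat with n by lia.
    revert a x Hx Hy Hstep.
    induction n as [|n IH]; intros a x Hx Hy Hstep.
    + simpl. rewrite Hx, Hy. apply chain_one. rewrite <- Hx, <- Hy. apply Hstep. lia.
    + rewrite decomp_sum by lia. simpl pred. rewrite Hx. apply chain_cons.
      * rewrite <- Hx. apply Hstep. lia.
      * apply (IH (fun i => a (S i))); auto.
        intros i Hi. apply Hstep. lia.
  - induction 1 as [x y Hxy | x z y s Hxz _ (n & a & Hn & Hz & Hy & Hstep & Hs)].
    + exists 2%nat, (fun i => match i with O => x | S _ => y end).
      repeat split; auto.
      intros i Hi. replace i with 0%nat by lia. exact Hxy.
    + exists (S n), (fun i => match i with O => x | S j => a j end).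
      destruct n as [|[|n]]; [lia|lia|].
      replace (S (S n) - 1)%nat with (S n) in Hy, Hstep by lia.
      replace (S (S n) - 2)%nat with n in Hs by lia.
      split; [lia|]. split; [reflexivity|].
      replace (S (S (S n)) - 1)%nat with (S (S n)) by lia.
      replace (S (S (S n)) - 2)%nat with (S n) by lia.
      split; [exact Hy|]. split.
      * intros [|i] Hi; [rewrite Hz; exact Hxz|]. apply Hstep. lia.
      * rewrite decomp_sum by lia. simpl pred. rewrite Hz, Hs. reflexivity.
Qed.

Lemma chain_cat (x y z : X) (s t : R) :
  chain d D delta x y s -> chain d D delta y z t -> chain d D delta x z (s + t).
Proof.
  induction 1 as [x y Hxy | x w y s Hxw _ IH]; intros Ht.
  - apply chain_cons; auto.
  - rewrite Rplus_assoc. apply chain_cons; auto.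
Qed.

(** The set of points reachable from [x] and its complement both contain the [delta]-ball about each
    of their points, so both are open; the first contains [x]. *)
Lemma connected_chain (x y : X) :
  is_metric d -> connected_metric d -> 0 < delta -> exists s, chain d D delta x y s.
Proof.
  intros (_ & d0 & sym & _) Hconn Hdelta.
  destruct (Hconn (fun z => exists s, chain d D delta x z s)) as [H|H].
  - intros z (s & Hs). exists delta. split; [exact Hdelta|]. intros w Hw.
    exists (s + D z z w). apply chain_cat with z; [exact Hs|]. apply chain_one. lra.
  - intros z Hz. exists delta. split; [exact Hdelta|]. intros w Hw (s & Hs). apply Hz.
    exists (s + D w w z). apply chain_cat with w; [exact Hs|]. apply chain_one.
    rewrite sym. lra.
  - apply H.
  - exfalso. apply (H x). exists (D x x x). apply chain_one.
    rewrite (proj2 (d0 x x) eq_refl). lra.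
Qed.

End Chains.

Lemma glb_exists (E : R -> Prop) (b : R) :
  (exists s, E s) -> is_lower_bound E b -> exists m, is_glb E m.
Proof.
  intros (s0 & Hs0) Hb.
  destruct (completeness (fun t => E (- t))) as (m & Hub & Hlub).
  - exists (- b). intros t Ht. specialize (Hb _ Ht). lra.
  - exists (- s0). rewrite Ropp_involutive. exact Hs0.
  - exists (- m). split.
    + intros s Hs. assert (- s <= m); [|lra].
      apply Hub. rewrite Ropp_involutive. exact Hs.
    + intros c Hc. assert (m <= - c); [|lra].
      apply Hlub. intros t Ht. specialize (Hc _ Ht). lra.
Qed.

(** * Comparison of [rho] with the local metric *)

Section LocalMetric.
Context {X : Type} (d : X -> X -> R) (D : X -> X -> X -> R) (delta delta0 : R).
Context (Hd : is_metric d) (Hc : compact_metric d) (Hconn : connected_metric d).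
Context (Hdelta : 0 < delta) (Hdelta0 : delta < delta0).
Context (HD : local_metric d delta0 D).

Lemma dist_self (x : X) : d x x = 0.
Proof. apply Hd. reflexivity. Qed.

Lemma local_self (x : X) : D x x x = 0.
Proof.
  destruct HD as (_ & _ & D0 & _).
  apply D0; [rewrite dist_self; lra .. | reflexivity].
Qed.

Lemma local_ge0 (x y : X) : d x y < delta0 -> 0 <= D x x y.
Proof.
  intros Hxy. destruct HD as (_ & Dpos & _).
  apply Dpos; [rewrite dist_self; lra | exact Hxy].
Qed.

Lemma local_eq0 (x y : X) : d x y < delta0 -> D x x y = 0 -> x = y.
Proof.
  intros Hxy. destruct HD as (_ & _ & D0 & _).
  apply D0; [rewrite dist_self; lra | exact Hxy].
Qed.

Lemma local_sym (x y : X) : d x y < delta0 -> D x x y = D y y x.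
Proof.
  intros Hxy. destruct Hd as (_ & _ & sym & _).
  destruct HD as (_ & _ & _ & Dsym & _ & Dbase).
  rewrite Dbase by exact Hxy.
  apply Dsym; [rewrite sym; exact Hxy | rewrite dist_self; lra].
Qed.

(** A positive continuous function on a compact set is bounded away from zero; [delta < delta0]
    keeps the closed band inside the domain of [D]. *)
Lemma local_lower_bound (r : R) : 0 < r ->
  exists m, 0 < m /\ forall x y, r <= d x y -> d x y <= delta -> m <= D x x y.
Proof.
  intros Hr. destruct Hd as (dpos & d0 & sym & tri).
  destruct HD as (Dcont & _).
  apply (compact_uniform2 d Hd Hc
    (fun m x y => r <= d x y -> d x y <= delta -> m <= D x x y)).
  - intros e e' x y He H H1 H2. specialize (H H1 H2). lra.
  - intros x y.
    assert (near : forall x' y' e, d x x' < e -> d y y' < e ->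
              Rabs (d x y - d x' y') < 2 * e).
    { intros x' y' e H1 H2.
      assert (T1 := tri x x' y). assert (T2 := tri x' y' y).
      assert (T3 := tri x' x y'). assert (T4 := tri x y y').
      rewrite (sym y' y) in T2. rewrite (sym x' x) in T3.
      apply Rabs_def1; lra. }
    (* If [(x, y)] lies outside the closed band, so do all nearby pairs, and the bound is vacuous
       there. *)
    destruct (Rlt_or_le (d x y) r) as [Hlt|Hge].
    { exists ((r - d x y) / 2). split; [lra|]. intros x' y' H1 H2 H3 H4.
      destruct (Rabs_def2 _ _ (near x' y' _ H1 H2)). lra. }
    destruct (Rlt_or_le delta (d x y)) as [Hgt|Hle].
    { exists ((d x y - delta) / 2). split; [lra|]. intros x' y' H1 H2 H3 H4.
      destruct (Rabs_def2 _ _ (near x' y' _ H1 H2)). lra. }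
    assert (Hpos : 0 < D x x y).
    { destruct (Rle_lt_or_eq_dec _ _ (local_ge0 x y ltac:(lra))) as [H|H]; [exact H|].
      symmetry in H. apply local_eq0 in H; [|lra].
      apply (d0 x y) in H. lra. }
    destruct (Dcont x x y) with (eps := D x x y / 2) as (eta & Heta & Hnear).
    { split; [rewrite dist_self|]; lra. }
    { lra. }
    exists (Rmin eta (D x x y / 2)). split; [apply Rmin_glb_lt; lra|].
    intros x' y' H1 H2 H3 H4.
    assert (Hl := Rmin_l eta (D x x y / 2)). assert (Hr' := Rmin_r eta (D x x y / 2)).
    destruct (Rabs_def2 (D x' x' y' - D x x y) (D x x y / 2)); [|lra].
    apply Hnear; [split; [rewrite dist_self|]; lra | lra ..].
Qed.

(** Continuity of [D] at the diagonal points [(x, x, x)], where it vanishes, made uniform. *)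
Lemma local_upper_bound (m : R) : 0 < m ->
  exists e, 0 < e /\ forall x y, d x y < e -> D x x y < m.
Proof.
  intros Hm. destruct Hd as (dpos & d0 & sym & tri).
  destruct HD as (Dcont & _).
  apply (compact_uniform d Hd Hc (fun e x => forall y, d x y < e -> D x x y < m)).
  - intros e e' x He H y Hy. apply H. lra.
  - intros x.
    destruct (Dcont x x x) with (eps := m) as (eta & Heta & Hnear).
    { split; rewrite dist_self; lra. }
    { exact Hm. }
    exists (Rmin (eta / 2) delta). split; [apply Rmin_glb_lt; lra|].
    intros y Hy z Hz.
    assert (Hl := Rmin_l (eta / 2) delta). assert (Hr := Rmin_r (eta / 2) delta).
    assert (T := tri x y z).
    destruct (Rabs_def2 (D y y z - D x x x) m); [|rewrite local_self in *; lra].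
    apply Hnear; [split; [rewrite dist_self|]; lra | lra ..].
Qed.

Lemma chain_ge0 (x y : X) (s : R) : chain d D delta x y s -> 0 <= s.
Proof.
  induction 1 as [x y Hxy | x z y s Hxz _ IH].
  - apply local_ge0. lra.
  - assert (0 <= D x x z) by (apply local_ge0; lra). lra.
Qed.

Lemma chain_rev (x y : X) (s : R) : chain d D delta x y s -> chain d D delta y x s.
Proof.
  destruct Hd as (_ & _ & sym & _).
  induction 1 as [x y Hxy | x z y s Hxz _ IH]; rewrite local_sym by lra.
  - apply chain_one. rewrite sym. exact Hxy.
  - rewrite Rplus_comm. apply chain_cat with z; [exact IH|].
    apply chain_one. rewrite sym. exact Hxz.
Qed.

(** Connectedness makes the set of sums nonempty and 0 bounds it below, so the [epsilon] in [rho]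
    does select an infimum. *)
Lemma rho_glb (x y : X) : is_glb (chain_sums d D delta x y) (rho d D delta x y).
Proof.
  unfold rho. apply epsilon_spec. apply glb_exists with 0.
  - destruct (connected_chain d D delta x y Hd Hconn Hdelta) as (s & Hs).
    exists s. apply chain_sumsP. exact Hs.
  - intros s Hs. apply chain_sumsP in Hs. apply chain_ge0 in Hs. exact Hs.
Qed.

Lemma rho_le_chain (x y : X) (s : R) : chain d D delta x y s -> rho d D delta x y <= s.
Proof. intros Hs. apply (proj1 (rho_glb x y)). apply chain_sumsP. exact Hs. Qed.

Lemma le_rho (x y : X) (b : R) :
  (forall s, chain d D delta x y s -> b <= s) -> b <= rho d D delta x y.
Proof.
  intros H. apply (proj2 (rho_glb x y)). intros s Hs. apply H, chain_sumsP, Hs.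
Qed.

Lemma rho_le_local (x y : X) : d x y <= delta -> rho d D delta x y <= D x x y.
Proof. intros H. apply rho_le_chain, chain_one, H. Qed.

Lemma rho_sym_le (x y : X) : rho d D delta x y <= rho d D delta y x.
Proof. apply le_rho. intros s Hs. apply rho_le_chain, chain_rev, Hs. Qed.

Lemma rho_triangle (x y z : X) :
  rho d D delta x z <= rho d D delta x y + rho d D delta y z.
Proof.
  (* The two infima on the right are handled one at a time, each isolated so that [le_rho]
     applies. *)
  enough (rho d D delta x z - rho d D delta y z <= rho d D delta x y) by lra.
  apply le_rho. intros s Hs.
  enough (rho d D delta x z - s <= rho d D delta y z) by lra.
  apply le_rho. intros t Ht.
  assert (H := rho_le_chain _ _ _ (chain_cat _ _ _ _ _ _ _ _ Hs Ht)). lra.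
Qed.

Context (Hmin : locally_minimizing d D delta).

Lemma local_triangle (x z y : X) :
  d x y < delta -> d x z < delta -> d z y < delta -> D x x y <= D x x z + D z z y.
Proof.
  intros Hxy Hxz Hzy. destruct Hd as (_ & _ & sym & _).
  destruct HD as (_ & _ & _ & _ & Dtri & Dbase).
  apply Rle_trans with (D z x y).
  - apply Hmin; [exact Hxy | exact Hxz | rewrite sym; exact Hzy].
  - rewrite (Dbase x z) by lra.
    apply Dtri; [rewrite sym | rewrite dist_self |]; lra.
Qed.

Section LowerBound.
Context (r m : R) (Hr : 2 * r <= delta).
Context (Hm : forall x y, r <= d x y -> d x y <= delta -> m <= D x x y).

(** A second step of length at least [r] already costs [m]. Otherwise [y] is within [2 * r <= delta]
    of [x], so [local_triangle] merges the two steps, and the merged step costs [m] if it leaves the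
    [r]-ball. *)
Lemma step_dichotomy (x z y : X) : d x z < r -> d z y <= delta ->
  m <= D x x z + D z z y \/ (d x y < r /\ D x x y <= D x x z + D z z y).
Proof.
  intros Hxz Hzy. destruct Hd as (dpos & _ & _ & tri).
  assert (P1 := dpos x z). assert (T := tri x z y).
  assert (L1 : 0 <= D x x z) by (apply local_ge0; lra).
  destruct (Rlt_or_le (d z y) r) as [Hlt|Hge].
  - assert (D x x y <= D x x z + D z z y) by (apply local_triangle; lra).
    destruct (Rlt_or_le (d x y) r) as [H1|H1]; [right; auto|].
    left. assert (m <= D x x y) by (apply Hm; lra). lra.
  - left. assert (m <= D z z y) by (apply Hm; lra). lra.
Qed.

(** The chain is absorbed from the front: the part already traversed is kept as one step from [x] to
    [z], which [step_dichotomy] merges with the next link. *)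
Lemma chain_dichotomy (x z y : X) (s : R) : d x z < r -> chain d D delta z y s ->
  m <= D x x z + s \/ (d x y < r /\ D x x y <= D x x z + s).
Proof.
  intros Hxz Hs. revert Hxz.
  induction Hs as [z y Hzy | z w y s Hzw Hs IH]; intros Hxz.
  - apply step_dichotomy; assumption.
  - apply chain_ge0 in Hs.
    destruct (step_dichotomy x z w Hxz Hzw) as [H|[H1 H2]]; [left; lra|].
    destruct (IH H1) as [H|[H3 H4]]; [left; lra|right; split; lra].
Qed.

Lemma rho_dichotomy (x y : X) : 0 < r ->
  m <= rho d D delta x y \/ (d x y < r /\ D x x y <= rho d D delta x y).
Proof.
  intros Hr0.
  assert (H : forall s, chain d D delta x y s -> m <= s \/ (d x y < r /\ D x x y <= s)).
  (* The absorption starts from the trivial step from [x] to [x], of cost 0. *)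
  { intros s Hs. rewrite <- (Rplus_0_l s), <- (local_self x).
    apply chain_dichotomy; [rewrite dist_self; exact Hr0 | exact Hs]. }
  destruct (Rle_or_lt m (rho d D delta x y)) as [Hle|Hlt]; [left; exact Hle|right].
  destruct (classic (exists s, chain d D delta x y s /\ s < m)) as [(s & Hs & Hsm)|Hno].
  - destruct (H s Hs) as [H1|[Hxy H1]]; [lra|]. split; [exact Hxy|].
    (* The cheap chain gives [D x x y <= s < m], so chains of sum at least [m] also cost at least
       [D x x y]. *)
    destruct (Rle_or_lt (D x x y) m) as [H2|H2]; [|lra].
    apply le_rho. intros t Ht. destruct (H t Ht) as [H3|[_ H3]]; lra.
  - exfalso. apply (Rlt_not_le _ _ Hlt). apply le_rho. intros s Hs.
    destruct (Rle_or_lt m s) as [H1|H1]; [exact H1|]. exfalso. eauto.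
Qed.

End LowerBound.

(** Close enough to the diagonal [D x x y < m], and [rho] is at most that, which rules out the first
    alternative of [rho_dichotomy]. *)
Lemma rho_eq_local :
  exists e, 0 < e /\ forall x y, d x y < e -> rho d D delta x y = D x x y.
Proof.
  destruct (local_lower_bound (delta / 2)) as (m & Hm0 & Hm); [lra|].
  destruct (local_upper_bound m Hm0) as (e & He & Hup).
  exists (Rmin e delta). split; [apply Rmin_glb_lt; assumption|].
  intros x y Hxy.
  assert (Hl := Rmin_l e delta). assert (Hr := Rmin_r e delta).
  assert (H1 := rho_le_local x y ltac:(lra)). assert (H2 := Hup x y ltac:(lra)).
  destruct (rho_dichotomy (delta / 2) m ltac:(lra) Hm x y ltac:(lra)) as [H|[_ H]]; lra.
Qed.

Lemma rho_small (r : R) : 0 < r ->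
  exists m, 0 < m /\ forall x y, rho d D delta x y < m -> d x y < r.
Proof.
  (* Capping the radius at [delta / 2] secures the condition [2 * r' <= delta] of
     [rho_dichotomy]. *)
  intros Hr. set (r' := Rmin r (delta / 2)).
  assert (Hl := Rmin_l r (delta / 2)). assert (Hr' := Rmin_r r (delta / 2)).
  assert (Hr0 : 0 < r') by (apply Rmin_glb_lt; lra). fold r' in Hl, Hr'.
  destruct (local_lower_bound r' Hr0) as (m & Hm0 & Hm).
  exists m. split; [exact Hm0|]. intros x y Hxy.
  destruct (rho_dichotomy r' m ltac:(lra) Hm x y Hr0) as [H|[H _]]; lra.
Qed.

Lemma rho_metric : is_metric (rho d D delta).
Proof.
  destruct Hd as (dpos & d0 & _).
  assert (pos : forall x y, 0 <= rho d D delta x y).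
  { intros x y. apply le_rho. intros s. apply chain_ge0. }
  split; [exact pos|]. split; [|split; [|exact rho_triangle]].
  - intros x y. split.
    + intros H. apply d0. apply Rle_antisym; [|apply dpos].
      apply Rnot_lt_le. intros Hxy.
      destruct (rho_small (d x y) Hxy) as (m & Hm & Hs).
      assert (Hlt := Hs x y ltac:(lra)). lra.
    + intros <-. apply Rle_antisym; [|apply pos].
      apply Rle_trans with (D x x x); [apply rho_le_local; rewrite dist_self; lra|].
      rewrite local_self. lra.
  - intros x y. apply Rle_antisym; apply rho_sym_le.
Qed.

(** [rho_small] puts [rho]-balls inside [d]-balls, and [local_upper_bound] gives the converse. *)
Lemma rho_topology (U : X -> Prop) : open_in d U <-> open_in (rho d D delta) U.
Proof.
  split; intros HU x Hx; destruct (HU x Hx) as (r & Hr & Hball).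
  - destruct (rho_small r Hr) as (m & Hm & Hs). exists m. split; auto.
  - destruct (local_upper_bound r Hr) as (e & He & Hup).
    exists (Rmin e delta). split; [apply Rmin_glb_lt; assumption|]. intros y Hy.
    assert (H1 := Rmin_l e delta). assert (H2 := Rmin_r e delta).
    apply Hball. apply Rle_lt_trans with (D x x y).
    + apply rho_le_local. lra.
    + apply Hup. lra.
Qed.

End LocalMetric.

(** * The catenary identity for [rho] *)

Theorem mainTheorem20 (X : Type) (dist : X -> X -> R) (f finv : X -> X)
  (D : X -> X -> X -> R) (delta0 delta : R) :
  is_metric dist -> compact_metric dist -> connected_metric dist ->
  homeomorphism dist f finv ->
  0 < delta -> delta < delta0 ->
  local_metric dist delta0 D ->
  catenary_local dist delta0 f finv D ->
  locally_minimizing dist D delta ->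
  catenary_metric dist f finv (rho dist D delta).
Proof.
  intros Hd Hc Hconn (_ & _ & Hf & Hg) Hdelta Hdelta0 HD Hcat Hmin.
  split; [eapply rho_metric; eassumption|].
  split; [intros U; eapply rho_topology; eassumption|].
  destruct (rho_eq_local dist D delta delta0) as (e0 & He0 & Heq0); auto.
  (* Below [e], [rho] agrees with [D] and the pair lies in the domain of [D]; [c] brings the images
     under [f] and [finv] below [e] too. *)
  pose (e := Rmin e0 delta0).
  assert (He : 0 < e) by (apply Rmin_glb_lt; lra).
  assert (L1 : e <= e0) by apply Rmin_l. assert (L2 : e <= delta0) by apply Rmin_r.
  destruct (uniform_continuity dist Hd Hc f e Hf He) as (a & Ha & Hfa).
  destruct (uniform_continuity dist Hd Hc finv e Hg He) as (b & Hb & Hgb).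
  pose (c := Rmin e (Rmin a b)).
  assert (Hc0 : 0 < c) by (repeat apply Rmin_glb_lt; lra).
  assert (L3 : c <= e) by apply Rmin_l.
  assert (L4 : c <= a) by (eapply Rle_trans; [apply Rmin_r | apply Rmin_l]).
  assert (L5 : c <= b) by (eapply Rle_trans; [apply Rmin_r | apply Rmin_r]).
  (* Halving turns the non-strict bound on the distance into the strict one needed. *)
  exists (c / 2). split; [lra|]. intros x y Hxy.
  assert (H1 := Hfa x y ltac:(lra)). assert (H2 := Hgb x y ltac:(lra)).
  rewrite !Heq0 by lra.
  apply Hcat; split; try rewrite (dist_self dist Hd); lra.
Qed.
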